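(* Let $\mathbb{S}$ be a metric space with its Borel $\sigma$-field, let $\{\mu_n\}_{n=1,2,\ldots}$ be a sequence of measures on $\mathbb{S}$ converging weakly to a finite measure $\mu$ on $\mathbb{S}$, and let $\{f_n,g_n\}_{n=1,2,\ldots}$ be measurable $[-\infty,+\infty]$-valued functions on $\mathbb{S}$ such that $f_n(s)\ge g_n(s)$ for all $n$ and $s\in\mathbb{S}$, and $$-\infty<\int_{\mathbb{S}}\limsup_{n\to\infty,\,s'\to s} g_n(s')\,\mu(ds)\le\liminf_{n\to\infty}\int_{\mathbb{S}} g_n(s)\,\mu_n(ds).$$ If the functions $\{g_n\}_{n=1,2,\ldots}$ are uniformly bounded from above (by one constant), then there exists $N\in\{0,1,2,\ldots\}$ such that $\{f_{n+N}^-\}_{n=1,2,\ldots}$ is uniformly integrable with respect to $\{\mu_{n+N}\}_{n=1,2,\ldots}$.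
   Context: Weak convergence: $\int f\,d\mu_n\to\int f\,d\mu$ for all bounded continuous $f$. $f^-=-\min\{f,0\}$. Integrals of extended-real functions are $\int f^+-\int f^-$, defined when one of these is finite; all integrals in the hypotheses are assumed defined. $\limsup_{n\to\infty,s'\to s}g_n(s'):=\inf_{n\ge1,\delta>0}\sup_{m\ge n,\,s'\in B_\delta(s)}g_m(s')$, with $B_\delta(s)$ the ball of radius $\delta$ around $s$. A sequence $\{h_n\}$ is uniformly integrable with respect to $\{\nu_n\}$ if $\lim_{K\to+\infty}\sup_{n}\int|h_n|\,\mathbf{1}\{|h_n|\ge K\}\,d\nu_n=0$. *)

(* Defs.v *)
From HB Require Import structures.
From mathcomp Require Import all_boot all_order all_algebra.
From mathcomp Require Import all_classical all_reals all_analysis.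
From mathcomp Require Import measurable_realfun measure lebesgue_integral sequences.
Set Implicit Arguments. Unset Strict Implicit. Unset Printing Implicit Defensive.
Import Order.TTheory GRing.Theory Num.Theory.
Import numFieldNormedType.Exports.
Local Open Scope classical_set_scope.
Local Open Scope ring_scope.
Local Open Scope ereal_scope.

Notation borel S := (@g_sigma_algebraType (S : pointedType) (@open S)).

(* limsup_{n -> oo, s' -> s} g_n(s')
   := inf_{n, delta > 0} sup_{m >= n, s' in B_delta(s)} g_m(s').
   Sequences are indexed from 0 (index 0 is the paper's index 1). *)
Definition joint_limsup {R : realType} {S : pseudoMetricType R}
    (g : nat -> S -> \bar R) (s : S) : \bar R :=
  ereal_inf [set y | exists n : nat, exists2 delta : R, (0 < delta)%R &
     y = ereal_sup [set z | exists m : nat, exists2 s' : S,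
                          (n <= m)%N /\ ball s delta s' & z = g m s']].

Definition weak_conv {R : realType} {S : ptopologicalType}
    (mu_ : nat -> {measure set (borel S) -> \bar R})
    (mu : {measure set (borel S) -> \bar R}) : Prop :=
  forall f : S -> R, continuous f -> (exists M : R, forall x, (`|f x| <= M)%R) ->
    (fun n => \int[mu_ n]_x (f x)%:E) @ \oo --> \int[mu]_x (f x)%:E.

Definition unif_integrable {R : realType} {S : ptopologicalType}
    (h : nat -> S -> \bar R) (nu : nat -> {measure set (borel S) -> \bar R})
    : Prop :=
  (fun K : R => ereal_sup [set \int[nu n]_(x in [set x | K%:E <= `|h n x|])
                                 `|h n x| | n in [set: nat]])
    @ +oo%R --> (0 : \bar R).

Definition integral_defined {R : realType} {S : ptopologicalType}
    (nu : {measure set (borel S) -> \bar R}) (g : S -> \bar R) : Prop :=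
  \int[nu]_x (g^\+ x) < +oo \/ \int[nu]_x (g^\- x) < +oo.

(* Main.v *)
(* Let C >= 0 bound the g_n and put u_n = C - g_n >= 0, so that f_n^- <= u_n.
   The function U = C - joint_limsup g is the increasing limit of the bounded
   k-Lipschitz functions
     psi_k(s) = inf {min(u_m(s'), k) + k d(s, s') | m >= k},
   which satisfy psi_k <= min(u_n, k) for n >= k.  By monotone convergence some
   psi_k has mu-integral within e of that of U; weak convergence applied to
   psi_k and to 1, with the hypothesis limsup int u_n dmu_n <= int U dmu, then
   makes int (u_n - psi_k) dmu_n <= O(e) for large n.  As psi_k <= k <= u_n / 2
   where u_n >= 2k, this bounds the tails of u_n.  The finitely many remaining
   u_n are integrable. *)
Require Import Defs.
From HB Require Import structures.
From mathcomp Require Import all_boot all_order all_algebra.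
From mathcomp Require Import all_classical all_reals all_analysis.
From mathcomp Require Import measurable_realfun measure lebesgue_integral sequences.
From mathcomp Require Import lra.
Import Order.TTheory GRing.Theory Num.Theory.
Import numFieldNormedType.Exports.
Local Open Scope classical_set_scope.
Local Open Scope ring_scope.
Local Open Scope ereal_scope.

(** * Truncation of nonnegative extended reals to real values *)

Definition trunc {R : realType} (k : nat) (x : \bar R) : R :=
  fine (mine x k%:R%:E).

(** For [0 <= x] the minimum lies between 0 and [k], so [fine] does not fall back on its default
    value. *)
Lemma truncE (R : realType) k (x : \bar R) :
  0 <= x -> (trunc k x)%:E = mine x k%:R%:E.
Proof.
move=> x0; rewrite fineK// ge0_fin_numE; last by rewrite le_min x0 lee_fin ler0n.
by rewrite gt_min ltry orbT.
Qed.

Lemma trunc_ge0 (R : realType) k (x : \bar R) : 0 <= x -> (0 <= trunc k x)%R.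
Proof. by move=> x0; rewrite -lee_fin truncE// le_min x0 lee_fin ler0n. Qed.

Lemma trunc_le (R : realType) k (x : \bar R) : 0 <= x -> (trunc k x <= k%:R)%R.
Proof. by move=> x0; rewrite -lee_fin truncE// ge_min lexx orbT. Qed.

Lemma le_trunc (R : realType) k l (x : \bar R) :
  0 <= x -> (k <= l)%N -> (trunc k x <= trunc l x)%R.
Proof.
move=> x0 kl; rewrite -lee_fin !truncE// le_min ge_min lexx/=.
by rewrite ge_min lee_fin ler_nat kl orbT.
Qed.

(** * Lipschitz envelopes of a sequence of nonnegative functions *)

Definition penalized {R : realType} {S : pseudoMetricType R}
    (u : nat -> S -> \bar R) (k : nat) (s : S) : set R :=
  [set y | exists m s' (e : R), [/\ (k <= m)%N, (0 < e)%R, ball s e s' &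
     y = (trunc k (u m s') + k%:R * e)%R]].

(* The inf-convolution of the tail [u_k, u_(k+1), ...] truncated at [k]:
   the ball radius [e] plays the role of the distance from [s] to [s']. *)
Definition envelope {R : realType} {S : pseudoMetricType R}
    (u : nat -> S -> \bar R) (k : nat) (s : S) : R := inf (penalized u k s).

Section envelope.
Context {R : realType} {S : pseudoMetricType R}.
Variable u : nat -> S -> \bar R.
Hypothesis u0 : forall n s, 0 <= u n s.

Lemma penalized_neq0 k s : penalized u k s !=set0.
Proof.
exists (trunc k (u k s) + k%:R * 1)%R, k, s, 1%R; split => //.
exact: ballxx.
Qed.

Lemma penalized_ge0 k s : lbound (penalized u k s) 0%R.
Proof.
move=> _ [m [s' [e [_ e0 _ ->]]]].
by rewrite addr_ge0 ?trunc_ge0// mulr_ge0// ltW.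
Qed.

Lemma envelope_ge0 k s : (0 <= envelope u k s)%R.
Proof. exact: lb_le_inf (penalized_neq0 k s) (@penalized_ge0 k s). Qed.

Lemma envelope_le_penalized k m s s' e :
  (k <= m)%N -> (0 < e)%R -> ball s e s' ->
  (envelope u k s <= trunc k (u m s') + k%:R * e)%R.
Proof.
move=> km e0 ss'; apply: ge_inf; first by exists 0%R; exact: penalized_ge0.
by exists m, s', e.
Qed.

Lemma envelope_le_trunc k m s :
  (k <= m)%N -> (envelope u k s <= trunc k (u m s))%R.
Proof.
move=> km; apply/ler_addgt0Pr => e e0.
(* The point [s] competes only with a positive radius; radius [e / k.+1] costs at most [e], and the
   successor covers [k = 0]. *)
have k0 : (0 < k.+1%:R :> R)%R by rewrite ltr0n.
have ek0 : (0 < e / k.+1%:R)%R by rewrite divr_gt0.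
apply: (le_trans (envelope_le_penalized _ _ s s _ km ek0 (ballxx _ ek0))).
rewrite lerD2l mulrCA ler_piMr ?(ltW e0)// ler_pdivrMr// mul1r.
by rewrite ler_nat leqnSn.
Qed.

Lemma envelope_le k s : (envelope u k s <= k%:R)%R.
Proof. exact: le_trans (envelope_le_trunc k k s (leqnn k)) (trunc_le _ k _ (u0 k s)). Qed.

(** By the triangle inequality, a candidate for [t] at radius [d] is a candidate for [s] at radius
    [e + d], with extra penalty [k * e]. *)
Lemma envelope_lipschitz k s t e : (0 < e)%R -> ball s e t ->
  (envelope u k s <= envelope u k t + k%:R * e)%R.
Proof.
move=> e0 st; rewrite -lerBlDr; apply: lb_le_inf; first exact: penalized_neq0.
move=> _ [m [s' [d [km d0 ts' ->]]]]; rewrite lerBlDr -addrA -mulrDr.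
apply: envelope_le_penalized => //; first by rewrite addr_gt0.
by rewrite addrC; exact: ball_triangle st ts'.
Qed.

Lemma continuous_envelope k : continuous (envelope u k).
Proof.
move=> s; apply/cvgrPdist_le => e e0.
have k0 : (0 < k.+1%:R :> R)%R by rewrite ltr0n.
have ek0 : (0 < e / k.+1%:R)%R by rewrite divr_gt0.
have ke : (k%:R * (e / k.+1%:R) <= e)%R.
  by rewrite mulrCA ler_piMr ?(ltW e0)// ler_pdivrMr// mul1r ler_nat leqnSn.
apply: filterS (nbhsx_ballx s _ ek0) => t st.
have h1 := envelope_lipschitz k _ _ _ ek0 st.
have h2 := envelope_lipschitz k _ _ _ ek0 (ball_sym st).
move: ke h1 h2; set c := (k%:R * _)%R => ke h1 h2.
by rewrite ler_norml; apply/andP; split; lra.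
Qed.

(** Raising the index shrinks the tail and raises both the truncation level and the slope of the
    penalty. *)
Lemma envelope_homo s : {homo envelope u ^~ s : k l / (k <= l)%N >-> (k <= l)%R}.
Proof.
move=> k l kl; apply: lb_le_inf; first exact: penalized_neq0.
move=> _ [m [s' [e [lm e0 ss' ->]]]].
apply: le_trans (envelope_le_penalized k m s s' e (leq_trans kl lm) e0 ss') _.
by rewrite lerD ?le_trunc// ler_wpM2r ?(ltW e0)// ler_nat.
Qed.

End envelope.

(** * Pointwise limit of the envelopes and measurability of the joint upper limit *)

Lemma envelope_cvg (R : realType) (S : pseudoMetricType R)
    (g : nat -> S -> \bar R) (C : R) (s : S) : (forall n s, g n s <= C%:E) ->
  (envelope (fun n s => C%:E - g n s)%E k s)%:E @[k --> \oo]
    --> C%:E - joint_limsup g s.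
Proof.
move=> gC; set u := (fun n s => C%:E - g n s)%E.
have u0 n t : 0 <= u n t by rewrite /u sube_ge0 ?gC ?orbT.
have ndu : {homo (fun k => (envelope u k s)%:E) : k l / (k <= l)%N >-> k <= l}.
  by move=> k l kl; rewrite lee_fin envelope_homo.
suff <- : ereal_sup (range (fun k => (envelope u k s)%:E)) =
    C%:E - joint_limsup g s by exact: ereal_nondecreasing_cvgn.
apply/eqP; rewrite eq_le; apply/andP; split.
  (* Supremum at most the limit: on a ball so small that the penalty is at most [e], every [g m]
     with [k <= m] is at most [C - envelope u k s + e]. *)
  apply: ge_ereal_sup => _ [k _ <-].
  suff GC : joint_limsup g s <= (C - envelope u k s)%:E.
    by apply: le_trans (leeB (lexx C%:E) GC); rewrite -EFinB lee_fin; lra.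
  apply/lee_addgt0Pr => e e0.
  have k0 : (0 < k.+1%:R :> R)%R by rewrite ltr0n.
  have d0 : (0 < e / k.+1%:R)%R by rewrite divr_gt0.
  have kd : (k%:R * (e / k.+1%:R) <= e)%R.
    by rewrite mulrCA ler_piMr ?(ltW e0)// ler_pdivrMr// mul1r ler_nat leqnSn.
  apply: (@le_trans _ _ (ereal_sup [set z | exists m : nat, exists2 s' : S,
      (k <= m)%N /\ ball s (e / k.+1%:R)%R s' & z = g m s'])).
    by apply: ereal_inf_lbound; exists k, (e / k.+1%:R)%R.
  apply: ge_ereal_sup => _ [m [s' [km ss'] ->]].
  have h1 := envelope_le_penalized _ u0 k m s s' _ km d0 ss'.
  have : (trunc k (u m s'))%:E <= C%:E - g m s'.
    by rewrite truncE// ge_min lexx.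
  move: h1 kd; set t := trunc k _; set c := (k%:R * _)%R => h1 kd.
  case: (g m s') (gC m s') => [r| |] rC tr.
  - by move: rC tr; rewrite -EFinB -EFinD !lee_fin; lra.
  - by move: rC; rewrite leye_eq.
  - by rewrite leNye.
(* Conversely, if the supremum [q] missed the limit by more than [e], then [u m > q + e] would hold
   for late [m] on some ball around [s], which forces an envelope up to [q + e]. *)
apply/lee_addgt0Pr => e e0; rewrite leNgt; apply/negP.
set q := ereal_sup _.
have envq k : (envelope u k s)%:E <= q by apply: ereal_sup_ubound; exists k.
have : 0 <= q by apply: le_trans (envq 0%N); rewrite lee_fin envelope_ge0.
case: q envq => [q envq _|_ _|//]; last by rewrite ltNge leey.
rewrite -EFinD; set r := (q + e)%R => rG.
have : joint_limsup g s < (C - r)%:E.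
  by move: rG; case: (joint_limsup g s) => [x| |]//=;
    rewrite -?EFinB ?lte_fin ?ltNyr//; lra.
move=> /ereal_inf_lt[_ [n [d d0 ->]] supr].
(* With this [k] the tail starts after [n], truncation preserves the bound [r], and a radius of at
   least [d] already costs [r]. *)
pose k := maxn n (maxn (Num.bound r) (Num.bound (r / d)%R)).
suff : (r <= envelope u k s)%R.
  move=> rk; have := envq k; rewrite lee_fin /r in rk *; lra.
have rk : (r <= k%:R)%R.
  apply: le_trans (ltW (unstable.ltr_bound r)) _.
  by rewrite ler_nat !leq_max leqnn/= orbT.
have rdk : (r <= k%:R * d)%R.
  rewrite -ler_pdivrMr//; apply: le_trans (ltW (unstable.ltr_bound _)) _.
  by rewrite ler_nat !leq_max leqnn !orbT.
apply: lb_le_inf; first exact: penalized_neq0.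
move=> _ [m [s' [f [km f0 ss' ->]]]].
(* Large radii are excluded by the penalty, small ones by the lower bound on [u m] over the ball of
   radius [d]. *)
have [df|fd] := leP d f.
  apply: le_trans rdk _; rewrite -[leLHS]add0r lerD ?trunc_ge0//.
  by rewrite ler_wpM2l.
rewrite -[leLHS]addr0 lerD ?mulr_ge0 ?(ltW f0)//.
rewrite -lee_fin truncE// le_min lee_fin rk andbT /u.
have : g m s' < (C - r)%:E.
  apply: le_lt_trans supr; apply: ereal_sup_ubound; exists m, s' => //; split.
    by rewrite (leq_trans _ km)// leq_maxl.
  exact: le_ball (ltW fd) _ ss'.
by case: (g m s') => [x| |]//=; rewrite -?EFinB ?lte_fin ?lee_fin ?leey//; lra.
Qed.

Lemma measurable_envelope (R : realType) (S : pseudoPMetricType R)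
    (u : nat -> S -> \bar R) k : (forall n s, 0 <= u n s) ->
  measurable_fun [set: borel S] (envelope u k : borel S -> R).
Proof.
move=> u0; apply: (measurability _ (RGenOpens.measurableE R)).
move=> _ [_ [a [b ->] <-]]; rewrite setTI; apply: sub_sigma_algebra.
have /continuousP cu := continuous_envelope _ u0 k.
exact/cu/interval_open.
Qed.

(** The definition involves uncountable suprema and infima; measurability comes from the countable
    limit of continuous envelopes. *)
Lemma measurable_joint_limsup (R : realType) (S : pseudoPMetricType R)
    (g : nat -> S -> \bar R) (C : R) : (forall n s, g n s <= C%:E) ->
  measurable_fun [set: borel S] (joint_limsup g : borel S -> \bar R).
Proof.
move=> gC.
have mU : measurable_fun [set: borel S]
    ((fun s => C%:E - joint_limsup g s) : borel S -> \bar R).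
  apply: (emeasurable_fun_cvg
    (fun k (s : borel S) => (envelope (fun n s => C%:E - g n s)%E k s)%:E)).
    move=> k; apply/measurable_EFinP; apply: measurable_envelope => n s.
    by rewrite sube_ge0 ?gC ?orbT.
  by move=> s _; exact: envelope_cvg.
(* Subtracting twice from the real number [C] is the identity at infinite values as well. *)
have -> : joint_limsup g = (fun s => C%:E - (C%:E - joint_limsup g s)).
  apply/funext => s; case: (joint_limsup g s) => [r| |]//=.
  by rewrite -!EFinB subKr.
by apply: emeasurable_funB => //; exact: measurable_cst.
Qed.

(** * Tail estimate from a bounded minorant *)

(* Pointwise, psi + h / 2 <= u on the superlevel set: there psi <= K / 2 <= h / 2. *)
Lemma integral_superlevel_le d (T : measurableType d) (R : realType)
    (nu : {measure set T -> \bar R}) (u psi h : T -> \bar R) (k K e : R) :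
  measurable_fun setT u -> measurable_fun setT psi -> measurable_fun setT h ->
  (forall x, 0 <= psi x <= u x) -> (forall x, psi x <= k%:E) ->
  (forall x, 0 <= h x <= u x) -> (k * 2 <= K)%R ->
  \int[nu]_x u x < +oo -> \int[nu]_x u x <= \int[nu]_x psi x + e%:E ->
  \int[nu]_(x in [set x | K%:E <= h x]) h x <= (2 * e)%:E.
Proof.
move=> mu mpsi mh psiu psik hu kK uoo upsi.
have psi0 x : 0 <= psi x by case/andP: (psiu x).
have h0 x : 0 <= h x by case/andP: (hu x).
have u0 x : 0 <= u x by case/andP: (hu x) => /le_trans; exact.
set E := [set x | _].
have mE : measurable E.
  by rewrite -[E]setTI; exact: emeasurable_fun_c_infty.
have mhE : measurable_fun setT (h \_ E).
  by apply/(measurable_restrictT h mE); exact: measurable_funTS.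
have hE0 x : 0 <= (h \_ E) x by exact: erestrict_ge0.
have pw x : psi x + 2^-1%:E * (h \_ E) x <= u x.
  rewrite patchE; case: ifPn => [|_]; last first.
    by rewrite mule0 adde0; case/andP: (psiu x).
  rewrite inE /E/=; move: (psi0 x) (psik x) (hu x) => /=.
  case: (u x) => [a| |]; [|by move=> *; rewrite leey|
    by case: (h x) => [?| |] //=; rewrite andbF].
  case: (h x) => [b| |]; [|by rewrite leye_eq andbF|by []].
  case: (psi x) => [c| |]; [|by []|by []].
  rewrite -EFinM -EFinD !lee_fin => c0 ck /andP[b0 ba] Kb; lra.
rewrite integral_mkcond.
have : \int[nu]_x psi x + 2^-1%:E * \int[nu]_x (h \_ E) x <= \int[nu]_x u x.
  rewrite -ge0_integralZl_EFin//.
  rewrite -ge0_integralD//; last 2 first.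
  - by move=> x _; rewrite mule_ge0// lee_fin invr_ge0.
  - exact: measurable_funeM.
  apply: ge0_le_integral => //.
  - by move=> x _; rewrite adde_ge0// mule_ge0// lee_fin invr_ge0.
  - by apply: emeasurable_funD => //; exact: measurable_funeM.
move=> /le_trans/(_ upsi).
(* The integral of [psi] is finite, so it cancels; the coefficient 1/2 then turns [e] into
   [2 * e]. *)
have : \int[nu]_x psi x <= \int[nu]_x u x.
  by apply: ge0_le_integral => // x _; case/andP: (psiu x).
move=> /le_lt_trans/(_ uoo).
have : 0 <= \int[nu]_x psi x by exact: integral_ge0.
case: (\int[nu]_x psi x) => [c| |]//= _ _.
have : 0 <= \int[nu]_x (h \_ E) x by exact: integral_ge0.
case: (\int[nu]_x (h \_ E) x) => [b| |]//=.
  by rewrite -EFinM -!EFinD !lee_fin; lra.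
by rewrite gt0_muley ?lte_fin ?invr_gt0// addeC.
Qed.

(** * Functions bounded above on a space of finite measure *)

Section bounded_above.
Context d (T : measurableType d) (R : realType).
Variables (nu : {measure set T -> \bar R}) (w : T -> \bar R) (C : R).
Hypotheses (nu_fin : nu setT < +oo) (mw : measurable_fun setT w).
Hypotheses (C0 : (0 <= C)%R) (wC : forall x, w x <= C%:E).
Hypothesis wNy : -oo < \int[nu]_x w x.

Let cst_int : nu.-integrable setT (cst C%:E).
Proof.
apply/integrableP; split; first exact: measurable_cst.
by rewrite integral_cst//= lte_mul_pinfty.
Qed.

(** The positive part is dominated by an integrable constant, so an infinite integral of the
    negative part would make the whole integral [-oo]. *)
Lemma integrable_bounded_above : nu.-integrable setT w.
Proof.
have mwp := measurable_funepos mw.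
have mwn := measurable_funeneg mw.
have wp : \int[nu]_x w^\+ x < +oo.
  apply: (@le_lt_trans _ _ (\int[nu]_x (cst C%:E) x)).
    apply: ge0_le_integral => //.
    by move=> x _; rewrite funeposE ge_max wC lee_fin.
  by rewrite integral_cst// lte_mul_pinfty.
apply/integrableP; split => //.
rewrite (_ : (fun x => `|w x|) = w^\+ \+ w^\-); last by rewrite -fune_abse.
rewrite ge0_integralD//; apply: lte_add_pinfty => //.
move: wNy wp; rewrite integralE.
have : 0 <= \int[nu]_x w^\+ x by exact: integral_ge0.
have : 0 <= \int[nu]_x w^\- x by exact: integral_ge0.
case: (\int[nu]_x w^\- x) => [?| |] //; first by rewrite ltry.
by case: (\int[nu]_x w^\+ x) => [?| |].
Qed.

Lemma integral_bound_sub :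
  \int[nu]_x (C%:E - w x) = C%:E * nu setT - \int[nu]_x w x.
Proof.
rewrite (integralB measurableT cst_int integrable_bounded_above).
by rewrite integral_cst.
Qed.

End bounded_above.

(** * Limits, monotone approximation and a tail criterion for uniform integrability *)

Lemma cvg_near_between (R : realType) (v : nat -> \bar R) (l e : R) :
  v n @[n --> \oo] --> l%:E -> (0 < e)%R ->
  \forall n \near \oo, exists r, [/\ v n = r%:E, (l - e < r)%R & (r < l + e)%R].
Proof.
move=> /fine_cvgP[vfin /cvgrPdist_lt vl] e0.
apply: filterS2 vfin (vl e e0) => n vn; rewrite ltr_norml/= => /andP[l1 l2].
by exists (fine (v n)); rewrite fineK//; split => //; lra.
Qed.

Lemma lt_limn_einf_near (R : realType) (v : nat -> \bar R) (l : \bar R) :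
  l < limn_einf v -> \forall n \near \oo, l < v n.
Proof.
rewrite limn_einf_lim (cvg_lim _ (@cvg_einfs_sup _ v))//.
move=> /ereal_sup_gt[_ [n _ <-]] ln; exists n => // m /= nm.
by apply: lt_le_trans ln _; apply: ereal_inf_lbound; exists m.
Qed.

Lemma measurable_trunc d (T : measurableType d) (R : realType) (k : nat)
    (u : T -> \bar R) : (forall x, 0 <= u x) -> measurable_fun setT u ->
  measurable_fun setT (fun x => trunc k (u x)).
Proof.
move=> u0 mu; apply/measurable_EFinP.
rewrite (_ : _ \o _ = fun x => mine (u x) k%:R%:E).
  by apply: measurable_mine => //; exact: measurable_cst.
by apply/funext => x /=; rewrite truncE.
Qed.

Lemma trunc_cvg (R : realType) (x : \bar R) :
  0 <= x -> (trunc k x)%:E @[k --> \oo] --> x.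
Proof.
move=> x0; have -> : (fun k => (trunc k x)%:E) = (fun k => mine x k%:R%:E).
  by apply/funext => k; rewrite truncE.
case: x x0 => [r| |]// r0; last first.
  apply/cvgeyPge => A; exists (Num.bound A) => // k /= Ak.
  rewrite min_r ?leey// lee_fin (le_trans (ltW (unstable.ltr_bound A)))//.
  by rewrite ler_nat.
apply: cvg_near_cst; exists (Num.bound r) => // k /= rk.
rewrite min_l// lee_fin (le_trans (ltW (unstable.ltr_bound r)))//.
by rewrite ler_nat.
Qed.

(** Monotone convergence with a finite limit. It serves twice: for the envelopes under [mu], and for
    the truncations of one [u n] under [mu_ n]. *)
Lemma integral_le_nondecreasing_approx d (T : measurableType d) (R : realType)
    (nu : {measure set T -> \bar R}) (u : T -> \bar R)
    (psi : nat -> T -> \bar R) (e : R) :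
  (forall k, measurable_fun setT (psi k)) -> (forall k x, 0 <= psi k x) ->
  (forall x, {homo psi ^~ x : k l / (k <= l)%N >-> k <= l}) ->
  (forall x, psi k x @[k --> \oo] --> u x) ->
  \int[nu]_x u x < +oo -> (0 < e)%R ->
  exists k, \int[nu]_x u x <= \int[nu]_x psi k x + e%:E.
Proof.
move=> mpsi psi0 ndpsi psiu uoo e0.
have limpsi x : limn (psi ^~ x) = u x by exact/cvg_lim.
have : \int[nu]_x psi k x @[k --> \oo] --> \int[nu]_x u x.
  rewrite -(eq_integral _ _ (fun x _ => limpsi x)).
  by apply: cvg_monotone_convergence => // x _; exact: ndpsi.
have : 0 <= \int[nu]_x u x.
  apply: integral_ge0 => x _; rewrite -limpsi; apply: lime_ge.
    by apply/cvg_ex; exists (u x); exact: psiu.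
  exact: nearW.
case: (\int[nu]_x u x) uoo => [l| |]// _ _ /cvg_near_between/(_ e0).
move=> /filter_ex[k [r [kr lr _]]]; exists k.
by rewrite kr -EFinD lee_fin; lra.
Qed.

Lemma unif_integrable_tail (R : realType) (S : ptopologicalType)
    (h : nat -> S -> \bar R) (nu : nat -> {measure set (borel S) -> \bar R}) :
  (forall e : R, (0 < e)%R -> exists K0 : R, forall n (K : R), (K0 <= K)%R ->
     \int[nu n]_(x in [set x | K%:E <= `|h n x|]) `|h n x| <= e%:E) ->
  unif_integrable h nu.
Proof.
move=> tail; rewrite /unif_integrable.
set v := fun K : R => ereal_sup _.
have v0 K : 0 <= v K.
  apply: (@le_trans _ _
    (\int[nu 0%N]_(x in [set x | K%:E <= `|h 0%N x|]) `|h 0%N x|)).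
    exact: integral_ge0.
  by apply: ereal_sup_ubound; exists 0%N.
have ve (e : R) : (0 < e)%R -> \forall K \near +oo%R, v K <= e%:E.
  move=> /tail[K0 K0e].
  have : \forall K \near +oo%R, (K0 <= K)%R by apply: nbhs_pinfty_ge; exact: num_real.
  apply: filterS => K K0K.
  by apply: ge_ereal_sup => _ [n _ <-]; exact: K0e.
(* The supremum may be infinite for small [K]; the tail bound with error 1 makes it finite
   eventually. *)
have vfin : \forall K \near +oo%R, v K \is a fin_num.
  apply: filterS (ve 1%R ltr01) => K vK.
  by rewrite ge0_fin_numE// (le_lt_trans vK)// ltry.
apply/fine_cvgP; split => //; apply/cvgrPdist_le => e e0.
apply: filterS2 vfin (ve e e0) => K vK vKe.
rewrite sub0r normrN ger0_norm/=; last by rewrite fine_ge0.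
by rewrite -lee_fin fineK.
Qed.

(** * Consequences of weak convergence *)

Section weak_convergence.
Context {R : realType} {S : pseudoPMetricType R}.
Variables (mu_ : nat -> {measure set (borel S) -> \bar R}).
Variables (mu : {measure set (borel S) -> \bar R}).
Variables (g : nat -> borel S -> \bar R) (C : R).
Hypotheses (mu_fin : mu [set: borel S] < +oo) (mu_weak : weak_conv mu_ mu).
Hypothesis g_meas : forall n, measurable_fun [set: borel S] (g n).
Hypotheses (C0 : (0 <= C)%R) (gC : forall n s, g n s <= C%:E).
Hypothesis limsup_gtNy : -oo < \int[mu]_s joint_limsup g s.
Hypothesis limsup_le_liminf : \int[mu]_s joint_limsup g s
  <= limn_einf (fun n => \int[mu_ n]_s g n s).

Let u n s := C%:E - g n s.

Let u0 n s : 0 <= u n s.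
Proof. by rewrite /u sube_ge0 ?gC ?orbT. Qed.

Lemma cvg_mass : mu_ n [set: borel S] @[n --> \oo] --> mu [set: borel S].
Proof.
have mass (nu : {measure set (borel S) -> \bar R}) :
    \int[nu]_x (cst 1%R x)%:E = nu setT.
  exact: etrans (integral_cst nu measurableT 1%:E) (mul1e _).
rewrite -mass (_ : (fun n => _) = fun n => \int[mu_ n]_x (cst 1%R x)%:E).
  apply: mu_weak; first exact: cst_continuous.
  by exists 1%R => x; rewrite normr1.
by apply/funext => n; rewrite mass.
Qed.

(** This provides the shift [N]: finitely many initial measures may have infinite mass, or give
    [g n] the integral [-oo]. *)
Lemma near_integral_gtNy : \forall n \near \oo,
  mu_ n [set: borel S] < +oo /\ -oo < \int[mu_ n]_s g n s.
Proof.
have gt := lt_limn_einf_near _ _ _ (lt_le_trans limsup_gtNy limsup_le_liminf).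
have mass : \forall n \near \oo, mu_ n [set: borel S] < +oo.
  have := cvg_mass; have : 0 <= mu setT by exact: measure_ge0.
  case: (mu setT) mu_fin => [m| |]// _ _ /cvg_near_between/(_ ltr01).
  by apply: filterS => n [r [-> _ _]]; rewrite ltry.
by apply: filterS2 mass gt.
Qed.

Let joint_limsup_le s : joint_limsup g s <= C%:E.
Proof.
apply: (@le_trans _ _ (ereal_sup [set z | exists m : nat, exists2 s' : S,
    (0 <= m)%N /\ ball s (1 : R) s' & z = g m s'])).
  by apply: ereal_inf_lbound; exists 0%N, 1%R.
by apply: ge_ereal_sup => _ [m [s' _ ->]].
Qed.

(* [C - g_n] cannot lose mass at infinity: its integrals are asymptotically at
   most that of [C - joint_limsup g], which a bounded continuous minorant of
   the tail of [C - g_n] nearly attains. *)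
Lemma near_integral_le_envelope (e : R) : (0 < e)%R -> exists k,
  \forall n \near \oo, \int[mu_ n]_s (C%:E - g n s) <=
    \int[mu_ n]_s (envelope u k s)%:E + e%:E.
Proof.
(* Four errors of [e / 4] add up: the lower limit of the integrals of [g n], the masses times [C],
   the choice of [k], and weak convergence tested on the envelope. *)
move=> e0; have e40 : (0 < e / 4)%R by rewrite divr_gt0.
have mG := measurable_joint_limsup _ _ g C gC.
have menv k : measurable_fun [set: borel S]
    ((fun s => (envelope u k s)%:E) : borel S -> \bar R).
  by apply/measurable_EFinP; exact: measurable_envelope.
have env0 k s : 0 <= (envelope u k s)%:E by rewrite lee_fin envelope_ge0.
have := integral_bound_sub _ _ _ _ _ _ mu_fin mG C0 joint_limsup_le limsup_gtNy.
have := integrable_bounded_above _ _ _ _ _ _ mu_fin mG C0 joint_limsup_le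
  limsup_gtNy.
move=> /(integrable_fin_num measurableT).
have := lt_limn_einf_near _ (fun n => \int[mu_ n]_s g n s).
move: limsup_le_liminf.
case: (\int[mu]_s joint_limsup g s) => [M| |]// liminfM gtM _ intU.
have {gtM} gtM : \forall n \near \oo, (M - e / 4)%:E < \int[mu_ n]_s g n s.
  by apply: gtM; apply: lt_le_trans liminfM; rewrite lte_fin; lra.
have := cvg_mass; have : 0 <= mu setT by exact: measure_ge0.
case: (mu setT) mu_fin intU => [m| |]// _ intU _.
(* Dividing by [C + 1] allows [C = 0] and still keeps the error below [e / 4] after multiplication
   by [C]. *)
have C40 : (0 < e / 4 / (C + 1))%R by rewrite divr_gt0// ltr_wpDl.
move=> /cvg_near_between/(_ C40) mass.
have [k Uk] : exists k, \int[mu]_s (C%:E - joint_limsup g s) <=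
    \int[mu]_s (envelope u k s)%:E + (e / 4)%:E.
  apply: integral_le_nondecreasing_approx => //.
  - by move=> s k l kl; rewrite lee_fin envelope_homo.
  - by move=> s; exact: envelope_cvg.
  - by rewrite intU -EFinM -EFinB ltry.
exists k.
have wk : \int[mu_ n]_s (envelope u k s)%:E @[n --> \oo] -->
    \int[mu]_s (envelope u k s)%:E.
  apply: mu_weak; first exact: continuous_envelope.
  by exists k%:R => s; rewrite ger0_norm ?envelope_ge0 ?envelope_le.
have : \int[mu]_s (envelope u k s)%:E < +oo.
  apply: (@le_lt_trans _ _ (\int[mu]_s (cst k%:R%:E s))).
    apply: ge0_le_integral => // s _.
    by rewrite lee_fin envelope_le.
  by rewrite integral_cst// lte_mul_pinfty.
have : 0 <= \int[mu]_s (envelope u k s)%:E by exact: integral_ge0.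
move: wk Uk; rewrite intU.
case: (\int[mu]_s (envelope u k s)%:E) => [p| |]// + + _ _.
move=> /cvg_near_between/(_ e40) wk; rewrite -EFinM -EFinB -EFinD lee_fin => Uk.
apply: filterS (filterI near_integral_gtNy (filterI mass (filterI wk gtM))).
move=> n [[mun gn] [[r [mr _ rm]] [[q [-> pq _]] Mg]]].
rewrite (integral_bound_sub _ _ _ _ _ _ mun (g_meas n) C0 (gC n) gn) mr.
have Cr : (C * r <= C * m + e / 4)%R.
  have : (C * r <= C * (m + e / 4 / (C + 1)))%R by rewrite ler_wpM2l// ltW.
  move=> /le_trans; apply; rewrite mulrDr lerD2l mulrCA ler_piMr ?(ltW e40)//.
  by rewrite ler_pdivrMr ?ltr_wpDl// mul1r lerDl.
case: (\int[mu_ n]_s g n s) Mg => [x| |]//.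
  by rewrite lte_fin -EFinM -EFinB -EFinD lee_fin; lra.
(* If the integral of [g n] is [+oo], the left side is [-oo]. *)
by move=> _; rewrite addeNy leNye.
Qed.

End weak_convergence.

(** * Uniform integrability of the negative parts *)

Theorem theorem2p6 (R : realType) (S : pseudoPMetricType R)
  (S_metric : hausdorff_space S)
  (mu_ : nat -> {measure set (borel S) -> \bar R})
  (mu : {measure set (borel S) -> \bar R})
  (mu_fin : mu [set: borel S] < +oo)
  (mu_weak : weak_conv mu_ mu)
  (f g : nat -> borel S -> \bar R)
  (f_meas : forall n, measurable_fun [set: borel S] (f n))
  (g_meas : forall n, measurable_fun [set: borel S] (g n))
  (fg : forall n s, g n s <= f n s)
  (g_def : forall n, integral_defined (mu_ n) (g n))
  (lim_def : integral_defined mu (joint_limsup g))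
  (H1 : -oo < \int[mu]_s joint_limsup g s)
  (H2 : \int[mu]_s joint_limsup g s
          <= limn_einf (fun n => \int[mu_ n]_s g n s))
  (g_ub : exists C : R, forall n s, g n s <= C%:E) :
  exists N : nat,
    unif_integrable (fun n => (f (n + N)%N)^\-) (fun n => mu_ (n + N)%N).
Proof.
have [C0 gC0] := g_ub.
(* A nonnegative bound is needed for [- g n s <= C - g n s], hence for the domination of the
   negative part of [f n] by [u n]. *)
pose C := Num.max C0 0%R.
have C_ge0 : (0 <= C)%R by rewrite le_max lexx orbT.
have gC n s : g n s <= C%:E by rewrite (le_trans (gC0 n s))// lee_fin le_max lexx.
pose u n s := C%:E - g n s.
have u0 n s : 0 <= u n s by rewrite /u sube_ge0 ?gC ?orbT.
have mu_u n : measurable_fun [set: borel S] (u n).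
  by apply: emeasurable_funB => //; exact: measurable_cst.
have fu n s : 0 <= (f n)^\- s <= u n s.
  rewrite funenegE le_max lexx orbT/= ge_max u0 andbT.
  apply: (@le_trans _ _ (- g n s)); first by rewrite leeN2.
  by rewrite -[leLHS]add0e leeD2r// lee_fin.
have [N _ HN] := near_integral_gtNy mu_ mu g mu_fin mu_weak H1 H2.
have u_lty n : (N <= n)%N -> \int[mu_ n]_s u n s < +oo.
  move=> /HN[mun gn].
  have gint := integrable_bounded_above _ _ _ _ _ _ mun (g_meas n) C_ge0 (gC n) gn.
  rewrite (integral_bound_sub _ _ _ _ _ _ mun (g_meas n) C_ge0 (gC n) gn).
  have := integrable_fin_num measurableT gint.
  case: (\int[mu_ n]_s g n s) => [x| |]// _.
  have : 0 <= mu_ n setT by exact: measure_ge0.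
  by case: (mu_ n setT) mun => [m| |]// _ _; rewrite -EFinM -EFinB ltry.
exists N; apply: unif_integrable_tail => e e0.
have e20 : (0 < e / 2)%R by rewrite divr_gt0.
suff [K0 K0P] : exists K0 : R, forall n K, (N <= n)%N -> (K0 <= K)%R ->
    \int[mu_ n]_(x in [set x | K%:E <= (f n)^\- x]) (f n)^\- x <= e%:E.
  exists K0 => n K K0K; have fge0 s : `|(f (n + N)%N)^\- s| = (f (n + N)%N)^\- s.
    by rewrite gee0_abs//; case/andP: (fu (n + N)%N s).
  under eq_set do rewrite fge0.
  under eq_integral do rewrite fge0.
  by apply: K0P => //; exact: leq_addl.
(* Late and early indices share this estimate and differ only in the minorant [psi]; [e / 2] offsets
   the doubling in the superlevel bound. *)
have tail n (psi : borel S -> R) (k : nat) (K : R) :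
    measurable_fun setT psi -> (forall s, 0 <= (psi s)%:E <= u n s) ->
    (forall s, (psi s <= k%:R)%R) -> (N <= n)%N -> (k%:R * 2 <= K)%R ->
    \int[mu_ n]_s u n s <= \int[mu_ n]_s (psi s)%:E + (e / 2)%:E ->
    \int[mu_ n]_(x in [set x | K%:E <= (f n)^\- x]) (f n)^\- x <= e%:E.
  move=> mpsi psiu psik Nn kK upsi.
  rewrite (_ : e%:E = (2 * (e / 2))%:E); last by rewrite mulrCA divff// mulr1.
  apply: (integral_superlevel_le _ _ _ _ _ _ _ k%:R _ _ (mu_u n) _ _ psiu) => //.
  - exact/measurable_EFinP.
  - exact: measurable_funeneg.
  - exact: u_lty.
have [k [n0 _ kP]] := near_integral_le_envelope mu_ mu g C mu_fin mu_weak g_meas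
  C_ge0 gC H1 H2 _ e20.
(* For a single index, a truncation of [u n] is a good enough minorant; the arbitrary level 0 below
   [N] makes the choice function total. *)
have single n : exists kn, (N <= n)%N ->
    \int[mu_ n]_s u n s <= \int[mu_ n]_s (trunc kn (u n s))%:E + (e / 2)%:E.
  have [Nn|nN] := leqP N n; last by exists 0%N.
  have [||||kn knP] := integral_le_nondecreasing_approx _ _ _ (mu_ n) (u n)
    (fun l s => (trunc l (u n s))%:E) _ _ _ _ _ (u_lty n Nn) e20; last by exists kn.
  - by move=> l; apply/measurable_EFinP; exact: measurable_trunc.
  - by move=> l s; rewrite lee_fin trunc_ge0.
  - by move=> s l l' ll'; rewrite lee_fin le_trunc.
  - by move=> s; exact: trunc_cvg.
have [kk kkP] := choice single.
(* Twice the largest level in use: [k] for all late indices, [kk i] for the finitely many early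
   ones. *)
exists ((maxn k (\max_(i < maxn n0 k) kk i))%:R * 2)%R => n K Nn kK.
(* Beyond [n0] the integral estimate holds, and beyond [k] the envelope lies below [u n]. *)
have [|nn0] := leqP (maxn n0 k) n.
  rewrite geq_max => /andP[n0n kn].
  apply: (tail n (envelope u k) k) => //.
  - exact: measurable_envelope.
  - move=> s; rewrite lee_fin envelope_ge0//=.
    apply: (@le_trans _ _ (trunc k (u n s))%:E).
      by rewrite lee_fin envelope_le_trunc.
    by rewrite truncE// ge_min lexx.
  - by move=> s; exact: envelope_le.
  - by rewrite (le_trans _ kK)// ler_wpM2r// ler_nat leq_maxl.
  - exact: kP.
apply: (tail n (fun s => trunc (kk n) (u n s)) (kk n)) => //.
- exact: measurable_trunc.
- by move=> s; rewrite lee_fin trunc_ge0// truncE// ge_min lexx.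
- by move=> s; exact: trunc_le.
- rewrite (le_trans _ kK)// ler_wpM2r// ler_nat leq_max.
  by rewrite (leq_bigmax (Ordinal nn0)) orbT.
- exact: kkP.
Qed.
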